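(* Let $A$ be a Banach algebra. Then the following statements hold. (i) Let $\varphi\in\Delta(A)$. A bounded linear functional $d\in A^*$ is a continuous point derivation of $A$ at $\varphi$ if and only if $d^{**}$ is a continuous point derivation of $A^{**}$ at $\varphi^{**}\in\Delta(A^{**})$. (ii) If $A^{**}$ is point amenable, then $A$ is point amenable. (iii) If $A^{**}$ is 0-point amenable, then $A$ is 0-point amenable.
   Context: For a Banach algebra $A$, $\Delta(A)$ is the character space of $A$ (nonzero multiplicative linear functionals) and $\Delta_0(A)=\Delta(A)\cup\{0\}$. A continuous point derivation of $A$ at $\varphi\in\Delta_0(A)$ is a continuous linear functional $d$ on $A$ with $d(ab)=d(a)\varphi(b)+\varphi(a)d(b)$ for all $a,b\in A$. $A$ is point amenable (respectively 0-point amenable) if there is no nonzero continuous point derivation of $A$ at any element of $\Delta(A)$ (respectively $\Delta_0(A)$). The second dual $A^{**}$ is a Banach algebra under the first Arens product, $\langle \Phi\Psi,f\rangle=\langle\Phi,\Psi f\rangle$, where $\langle\Psi f,a\rangle=\langle\Psi,f\cdot a\rangle$ and $\langle f\cdot a,x\rangle=\langle f,ax\rangle$ for $\Phi,\Psi\in A^{**}$, $f\in A^*$, $a,x\in A$. For $f\in A^*$, $f^{**}\in (A^{**})^*$ denotes its second transpose, i.e. $f^{**}(\Phi)=\langle\Phi,f\rangle$ for $\Phi\in A^{**}$. *)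

(* Defs.v *)
From HB Require Import structures.
From mathcomp Require Import all_boot all_order all_algebra.
From mathcomp Require Import complex.
From mathcomp Require Import all_classical all_reals.
From mathcomp Require Import topology normedtype sequences.

Set Implicit Arguments.
Unset Strict Implicit.
Unset Printing Implicit Defensive.

Import Order.TTheory GRing.Theory Num.Theory.
Import numFieldNormedType.Exports.

Local Open Scope classical_set_scope.
Local Open Scope complex_scope.
Local Open Scope ring_scope.

Section complex_scalars.
Context {R : realType}.
Local Notation C := R[i].

Lemma ge0_Re (z : C) : 0 <= z -> (complex.Re z)%:C = z.
Proof. by move=> z0; rewrite RRe_real// ger0_real. Qed.

Lemma Re_leC (z : C) (M : R) : 0 <= z -> (complex.Re z <= M) = (z <= M%:C).
Proof. by move=> z0; rewrite -lecR ge0_Re. Qed.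

Lemma posC_realP (e : C) : 0 < e -> exists2 r : R, 0 < r & e = r%:C.
Proof.
move=> e0; exists (complex.Re e); last by rewrite RRe_real// gtr0_real.
by rewrite -ltcR RRe_real// gtr0_real.
Qed.

Lemma normc_ge_Im (x : C) : `|complex.Im x|%:C <= `|x|.
Proof. by rewrite normc_def lecR -sqrtr_sqr ler_wsqrtr// lerDr sqr_ge0. Qed.

Lemma normc_le_ReIm (x : C) :
  `|x| <= (`|complex.Re x| + `|complex.Im x|)%:C.
Proof.
rewrite {1}(complexE x) (le_trans (ler_normD _ _))// rmorphD lerD//.
  by rewrite normc_def /= (expr0n _ 2) addr0 sqrtr_sqr.
by rewrite normrM !normc_def /= (expr0n _ 2) (expr1n _ 2) add0r addr0 sqrtr1
  mul1r sqrtr_sqr.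
Qed.

Lemma complex_complete (F : set_system C^o) :
  ProperFilter F -> cauchy F -> cvg F.
Proof.
move=> FF /cauchy_ballP Fc.
have cv (g : C -> R^o) :
    (forall x y, `|g x - g y|%:C <= `|x - y|) -> cvg (g @ F).
  move=> gle; apply: cauchy_cvg; apply/cauchy_ballP => e e0; rewrite near_map2.
  have /Fc : 0 < e%:C by rewrite ltcR.
  apply: filterS => -[x y] /=.
  rewrite -!ball_normE /= => xy.
  by rewrite -ltcR (le_lt_trans (gle _ _)).
have Recv : cvg (@complex.Re R @ F).
  by apply: cv => x y; rewrite -raddfB; exact: normc_ge_Re.
have Imcv : cvg (@complex.Im R @ F).
  by apply: cv => x y; rewrite -raddfB; exact: normc_ge_Im.
case/cvg_ex: Recv => a /cvgrPdist_lt Fa; case/cvg_ex: Imcv => b /cvgrPdist_lt Fb.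
apply/cvg_ex; exists (a +i* b); apply/(@cvgrPdist_lt _ C^o) => e.
case/posC_realP => r r0 ->.
have r20 : 0 < r / 2 by rewrite divr_gt0.
near=> x.
rewrite (le_lt_trans (normc_le_ReIm _))// ltcR [ltRHS]splitr ltrD// raddfB/=.
- by near: x; exact: Fa.
- by near: x; exact: Fb.
Unshelve. all: by end_near. Qed.

End complex_scalars.

Section dual_space.
Context {R : realType}.
Local Notation C := R[i].
Variable V : normedModType C.

Definition continuous_linear_form : {pred V -> C^o} :=
  fun f => `[< linear f /\ continuous f >].

(* [C^o] is C as a normed module over itself. *)
Record dual := Dual {
  dual_fun :> V -> C^o ;
  dual_funP : dual_fun \in continuous_linear_form }.

Lemma continuous_linear_form_submod_closed :
  GRing.subsemimod_closed continuous_linear_form.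
Proof.
split; [split|].
- by apply/asboolP; split=> [k u v|]; [rewrite scaler0 addr0|exact: cst_continuous].
- move=> f g /asboolP[lf cf] /asboolP[lg cg]; apply/asboolP; split.
    by move=> k u v; rewrite /= !fctE lf lg scalerDr addrACA.
  by move=> x; apply: cvgD; [exact: cf|exact: cg].
- move=> k f /asboolP[lf cf]; apply/asboolP; split.
    move=> l u v; change (k *: f (l *: u + v) = l *: (k *: f u) + k *: f v).
    by rewrite lf scalerDr !scalerA mulrC.
  by move=> x; apply: (@cvgZ _ C^o); [exact: cvg_cst|exact: cf].
Qed.

HB.instance Definition _ := GRing.isSubmodClosed.Build C (V -> C^o)
  continuous_linear_form continuous_linear_form_submod_closed.

HB.instance Definition _ := [isSub for dual_fun].
HB.instance Definition _ := [Choice of dual by <:].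
HB.instance Definition _ := [SubChoice_isSubLmodule of dual by <:].

Lemma dualP (f g : dual) : (forall x, f x = g x) -> f = g.
Proof. by move=> fg; apply: val_inj; apply/funext. Qed.

Lemma dualD (f g : dual) x : (f + g) x = f x + g x.
Proof. by []. Qed.

Lemma dualB (f g : dual) x : (f - g) x = f x - g x.
Proof. by []. Qed.

Lemma dualZ k (f : dual) x : (k *: f) x = k * f x.
Proof. by []. Qed.

Lemma dual0 x : (0 : dual) x = 0.
Proof. by []. Qed.

Lemma dual_linear (f : dual) : linear f.
Proof. by have /asboolP[] := dual_funP f. Qed.

Lemma dual_continuous (f : dual) : continuous f.
Proof. by have /asboolP[] := dual_funP f. Qed.

HB.instance Definition _ (f : dual) :=
  GRing.isLinear.Build C V C^o *:%R f (dual_linear f).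
End dual_space.
Arguments continuous_linear_form {R} V _ : rename.

Section dual_norm.
Context {R : realType}.
Local Notation C := R[i].
Variable V : normedModType C.
Implicit Types (f g : dual V) (x : V).

Lemma continuous_linear_formP (f : V -> C^o) (M : R) :
  linear f -> (forall x, `|f x| <= M%:C * `|x|) ->
  f \in continuous_linear_form V.
Proof.
move=> lf Mf; apply/asboolP; split=> //.
pose L : {linear V -> C^o} :=
  HB.pack_for {linear V -> C^o} f (GRing.isLinear.Build C V C^o *:%R f lf).
apply: (@bounded_linear_continuous _ _ _ L); apply/linear_boundedP.
near=> r => x; apply: le_trans (Mf x) _; rewrite ler_wpM2r//.
near: r; apply: nbhs_pinfty_ge.
by rewrite complex_real.
Unshelve. all: by end_near. Qed.

Definition mk_dual (f : V -> C^o) (M : R) (lf : linear f)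
  (Mf : forall x, `|f x| <= M%:C * `|x|) : dual V :=
  Dual (continuous_linear_formP lf Mf).

Lemma dual_bounded f : exists M : R, forall x, `|f x| <= M%:C * `|x|.
Proof.
have /linear_bounded_continuous/linear_boundedP := @dual_continuous _ _ f.
case/pinfty_ex_gt0 => M M0 fM.
by have [r _ Mr] := posC_realP M0; exists r => x; rewrite -Mr; exact: fM.
Qed.

(* The norm of a [normedModType R[i]] takes its values in R[i], hence the
   coercion back from R. *)
Definition dual_norm f : C :=
  (sup [set complex.Re `|f x| | x in [set x | `|x| <= 1]])%:C.

Lemma dual_has_ubound f :
  has_ubound [set complex.Re `|f x| | x in [set x | `|x| <= 1]].
Proof.
have [M fM] := dual_bounded f; exists (Num.max M 0) => _ [y y1 <-].
rewrite Re_leC// (le_trans (fM y))//.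
rewrite (@le_trans _ _ ((Num.max M 0)%:C * `|y|))//.
  by rewrite ler_wpM2r// lecR le_max lexx.
by rewrite ler_piMr// ler0c le_max lexx orbT.
Qed.

Lemma dual_norm_le f (M : R) : 0 <= M ->
  (forall x, `|f x| <= M%:C * `|x|) -> dual_norm f <= M%:C.
Proof.
move=> M0 fM; rewrite lecR; apply: ge_sup.
  by exists (complex.Re `|f 0|), 0 => //; rewrite /= normr0.
move=> _ [x x1 <-]; rewrite Re_leC// (le_trans (fM x))//.
by rewrite ler_piMr// ler0c.
Qed.

Lemma le_dual_norm f x : `|f x| <= dual_norm f * `|x|.
Proof.
have [->|x0] := eqVneq x 0; first by rewrite linear0 !normr0 mulr0.
have nx0 : 0 < `|x| by rewrite normr_gt0.
rewrite -ler_pdivrMr// mulrC.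
have -> : `|x|^-1 * `|f x| = `|f (`|x|^-1 *: x)|.
  by rewrite linearZ normrZ normfV normr_id.
rewrite -[leLHS]ge0_Re// lecR; apply: ub_le_sup; first exact: dual_has_ubound.
exists (`|x|^-1 *: x) => //.
by rewrite /mkset normrZ normfV normr_id mulVf// gt_eqF.
Qed.

Lemma dual_norm_ge0 f : 0 <= dual_norm f.
Proof.
rewrite ler0c; apply: (@le_trans _ _ (complex.Re `|f 0|)).
  by rewrite -lecR ge0_Re; exact: normr_ge0.
apply: ub_le_sup; first exact: dual_has_ubound.
by exists 0 => //; rewrite /= normr0.
Qed.

Lemma dual_norm_le_bound f (M : C) : 0 <= M ->
  (forall x, `|f x| <= M * `|x|) -> dual_norm f <= M.
Proof.
by move=> M0 fM; rewrite -(ge0_Re M0); apply: dual_norm_le => [|x];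
  rewrite -?ler0c ge0_Re.
Qed.

Lemma ler_dual_normD f g : dual_norm (f + g) <= dual_norm f + dual_norm g.
Proof.
apply: dual_norm_le_bound => [|x]; first by rewrite addr_ge0// dual_norm_ge0.
by rewrite dualD mulrDl (le_trans (ler_normD _ _))// lerD// le_dual_norm.
Qed.

Lemma dual_normZ_le (k : C) f : dual_norm (k *: f) <= `|k| * dual_norm f.
Proof.
apply: dual_norm_le_bound => [|x]; first by rewrite mulr_ge0// dual_norm_ge0.
by rewrite dualZ normrM -mulrA ler_wpM2l// le_dual_norm.
Qed.

Lemma dual_normZ (k : C) f : dual_norm (k *: f) = `|k| * dual_norm f.
Proof.
apply/eqP; rewrite eq_le dual_normZ_le/=.
have [->|k0] := eqVneq k 0; first by rewrite normr0 mul0r dual_norm_ge0.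
rewrite -ler_pdivlMl ?normr_gt0// -normfV.
by rewrite -{1}[f](scalerK k0) dual_normZ_le.
Qed.

Lemma dual_norm0_eq0 f : dual_norm f = 0 -> f = 0.
Proof.
move=> f0; apply: dualP => x; apply/eqP.
by rewrite dual0 -normr_le0 (le_trans (le_dual_norm f x))// f0 mul0r.
Qed.

HB.instance Definition _ := Lmodule_isNormed.Build C (dual V)
  ler_dual_normD dual_normZ dual_norm0_eq0.

Lemma ler_dual f x : `|f x| <= `|f| * `|x|.
Proof. exact: le_dual_norm. Qed.

Lemma dual_ler f (M : C) : 0 <= M -> (forall x, `|f x| <= M * `|x|) -> `|f| <= M.
Proof. exact: dual_norm_le_bound. Qed.

Lemma dual_complete (F : set_system (dual V)) :
  ProperFilter F -> cauchy F -> cvg F.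
Proof.
move=> FF /cauchy_ballP Fc.
have Fx x : cvg ((fun f : dual V => f x : C^o) @ F).
  apply: complex_complete; apply/cauchy_ballP => e e0; rewrite near_map2.
  have /Fc : 0 < e / (`|x| + 1) by rewrite divr_gt0// ltr_wpDl.
  apply: filterS => -[f g] /=; rewrite -!ball_normE /= => fg.
  rewrite -dualB (le_lt_trans (le_dual_norm _ _))//.
  rewrite (@le_lt_trans _ _ (dual_norm (f - g) * (`|x| + 1)))//.
    by rewrite ler_wpM2l ?dual_norm_ge0// lerDl.
  by rewrite -ltr_pdivlMr// ltr_wpDl.
pose l x : C^o := lim ((fun f : dual V => f x : C^o) @ F).
have llin : linear l.
  move=> k u v; apply: cvg_lim => //.
  under eq_fun do rewrite linearP.
  by apply: cvgD; [apply: (@cvgZ _ C^o); [exact: cvg_cst|exact: Fx]|exact: Fx].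
have lle (f : dual V) (e : C) x : (\forall g \near F, `|f - g| <= e) ->
    `|f x - l x| <= e * `|x|.
  move=> fe; apply/ler_addgt0Pr => d d0.
  have /cvgrPdist_le/(_ d d0) ld := Fx x.
  near F => g.
  rewrite -(subrKA (g x)) (le_trans (ler_normD _ _))// lerD//; last first.
    by rewrite distrC; near: g.
  rewrite -dualB (le_trans (le_dual_norm _ _))// ler_wpM2r//.
  by near: g.
have /cauchyP/(_ 1 ltr01)[f0 f0F] : cauchy F by exact/cauchy_ballP.
have lbnd x : `|l x| <= (complex.Re (1 + `|f0|))%:C * `|x|.
  rewrite ge0_Re ?addr_ge0// mulrDl -[l x](subrK (f0 x)).
  rewrite (le_trans (ler_normD _ _))// lerD//; last exact: le_dual_norm.
  rewrite distrC; apply: lle.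
  by near=> g; apply/ltW; near: g; rewrite -ball_normE in f0F.
apply/cvg_ex; exists (mk_dual llin lbnd); apply/cvgrPdist_le => e e0.
have /Fc/nearP_dep Fe := e0.
near=> f.
rewrite distrC; apply: dual_norm_le_bound => [|x]; first exact: ltW.
rewrite dualB; apply: lle.
have : \forall g \near F, ball f e g by near: f.
by apply: filterS => g; rewrite -ball_normE => /ltW.
Unshelve. all: by end_near. Qed.

HB.instance Definition _ := Uniform_isComplete.Build (dual V) dual_complete.

End dual_norm.

HB.mixin Record CompleteNormedModule_isBanachAlgebra (K : numFieldType) A
    & CompleteNormedModule K A := {
  bmul : A -> A -> A ;
  bmulA : associative bmul ;
  bmulDl : left_distributive bmul +%R ;
  bmulDr : right_distributive bmul +%R ;
  bmulZl : forall (k : K) (a b : A), bmul (k *: a) b = k *: bmul a b ;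
  bmulZr : forall (k : K) (a b : A), bmul a (k *: b) = k *: bmul a b ;
  ler_norm_bmul : forall a b : A, `|bmul a b| <= `|a| * `|b| }.

(* Banach algebras are not assumed to be unital. *)
#[short(type="banachAlgType")]
HB.structure Definition BanachAlgebra (K : numFieldType) :=
  {A of CompleteNormedModule K A & CompleteNormedModule_isBanachAlgebra K A}.

Notation "a ** b" := (bmul a b) (at level 40, left associativity) : ring_scope.

Section arens.
Context {R : realType} {A : banachAlgType R[i]}.
Local Notation C := R[i].
Implicit Types (a b x : A) (f : dual A) (F G : dual (dual A)).

Fact dual_ract_linear f a : linear (fun x => f (a ** x) : C^o).
Proof. by move=> k x y; rewrite bmulDr bmulZr linearP. Qed.

Fact dual_ract_bounded f a x :
  `|f (a ** x)| <= (complex.Re (`|f| * `|a|))%:C * `|x|.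
Proof.
rewrite ge0_Re ?mulr_ge0// (le_trans (ler_dual _ _))// -mulrA.
by rewrite ler_wpM2l// ler_norm_bmul.
Qed.

(* <f . a, x> = <f, a x> *)
Definition dual_ract f a : dual A :=
  mk_dual (dual_ract_linear f a) (dual_ract_bounded f a).

Lemma ler_norm_dual_ract f a : `|dual_ract f a| <= `|f| * `|a|.
Proof.
apply: dual_ler => [|x]; first by rewrite mulr_ge0.
by rewrite (le_trans (dual_ract_bounded f a x))// ge0_Re ?mulr_ge0.
Qed.

Fact bidual_lact_linear G f : linear (fun a => G (dual_ract f a) : C^o).
Proof.
move=> k a b; rewrite -linearP; congr (G _); apply: dualP => x.
by rewrite dualD dualZ /= bmulDl bmulZl linearP.
Qed.

Fact bidual_lact_bounded G f a :
  `|G (dual_ract f a)| <= (complex.Re (`|G| * `|f|))%:C * `|a|.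
Proof.
rewrite ge0_Re ?mulr_ge0// (le_trans (ler_dual _ _))// -mulrA.
by rewrite ler_wpM2l// ler_norm_dual_ract.
Qed.

(* <G f, a> = <G, f . a> *)
Definition bidual_lact G f : dual A :=
  mk_dual (bidual_lact_linear G f) (bidual_lact_bounded G f).

Lemma ler_norm_bidual_lact G f : `|bidual_lact G f| <= `|G| * `|f|.
Proof.
apply: dual_ler => [|x]; first by rewrite mulr_ge0.
by rewrite (le_trans (bidual_lact_bounded G f x))// ge0_Re ?mulr_ge0.
Qed.

Fact arens_linear F G : linear (fun f => F (bidual_lact G f) : C^o).
Proof.
move=> k f g; rewrite -linearP; congr (F _); apply: dualP => a.
rewrite dualD dualZ /= -linearP; congr (G _); exact: dualP.
Qed.

Fact arens_bounded F G f :
  `|F (bidual_lact G f)| <= (complex.Re (`|F| * `|G|))%:C * `|f|.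
Proof.
rewrite ge0_Re ?mulr_ge0// (le_trans (ler_dual _ _))// -mulrA.
by rewrite ler_wpM2l// ler_norm_bidual_lact.
Qed.

(* The first Arens product: <F G, f> = <F, G f> *)
Definition arens F G : dual (dual A) :=
  mk_dual (arens_linear F G) (arens_bounded F G).

Lemma arensA : associative arens.
Proof.
move=> F G H; apply: dualP => f /=; congr (F _); apply: dualP => a /=.
congr (G _); apply: dualP => b /=; congr (H _); apply: dualP => x /=.
by rewrite bmulA.
Qed.

Lemma arensDl : left_distributive arens +%R.
Proof. by move=> F G H; apply: dualP => f; rewrite dualD. Qed.

Lemma arensDr : right_distributive arens +%R.
Proof.
move=> F G H; apply: dualP => f; rewrite dualD /= -linearD; congr (F _).
exact: dualP.
Qed.

Lemma arensZl k F G : arens (k *: F) G = k *: arens F G.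
Proof. by apply: dualP => f; rewrite dualZ. Qed.

Lemma arensZr k F G : arens F (k *: G) = k *: arens F G.
Proof.
apply: dualP => f; rewrite dualZ /=.
have -> : bidual_lact (k *: G) f = k *: bidual_lact G f by exact: dualP.
by rewrite linearZ.
Qed.

Lemma ler_norm_arens F G : `|arens F G| <= `|F| * `|G|.
Proof.
apply: dual_ler => [|x]; first by rewrite mulr_ge0.
by rewrite (le_trans (arens_bounded F G x))// ge0_Re ?mulr_ge0.
Qed.

End arens.

Definition bidual (R : realType) (A : banachAlgType R[i]) : Type :=
  dual (dual A).

HB.instance Definition _ (R : realType) (A : banachAlgType R[i]) :=
  CompleteNormedModule.copy (bidual A) (dual (dual A)).

HB.instance Definition _ (R : realType) (A : banachAlgType R[i]) :=
  CompleteNormedModule_isBanachAlgebra.Build R[i] (bidual A)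
    arensA arensDl arensDr arensZl arensZr ler_norm_arens.

Section point_derivations.
Context {R : realType}.
Local Notation C := R[i].
Implicit Types A : banachAlgType C.

(* Continuity is not part of the definition; it is automatic, see
   [ler_norm_character]. *)
Definition characters A : set (A -> C^o) :=
  [set phi | [/\ linear phi, forall a b, phi (a ** b) = phi a * phi b
               & exists a, phi a <> 0]].

Definition characters0 A : set (A -> C^o) :=
  @characters A `|` [set (fun=> 0)].

Definition point_derivation A (phi : A -> C^o) (d : dual A) : Prop :=
  forall a b, d (a ** b) = d a * phi b + phi a * d b.

Definition point_amenable A : Prop :=
  forall phi, characters phi ->
  forall d : dual A, point_derivation phi d -> d = 0.

Definition zero_point_amenable A : Prop :=
  forall phi, characters0 phi ->
  forall d : dual A, point_derivation phi d -> d = 0.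

End point_derivations.
Arguments characters {R} A.
Arguments characters0 {R} A.

Section automatic_continuity.
Context {R : realType} {A : banachAlgType R[i]}.
Local Notation C := R[i].
Implicit Types a b : A.

Lemma bmulBr a b c : a ** (b - c) = a ** b - a ** c.
Proof. by rewrite bmulDr -scaleN1r bmulZr scaleN1r. Qed.

Lemma bmul_continuous a : continuous (bmul a).
Proof.
move=> b; apply/cvgrPdist_le => e e0; near=> c.
rewrite -bmulBr (le_trans (ler_norm_bmul _ _))//.
rewrite (@le_trans _ _ ((`|a| + 1) * `|b - c|))//.
  by rewrite ler_wpM2r// lerDl.
rewrite -ler_pdivlMl ?ltr_wpDl//.
near: c; apply: (@cvgr_dist_le _ _ _ (nbhs b) _ id) => //.
by rewrite mulrC divr_gt0// ltr_wpDl.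
Unshelve. all: by end_near. Qed.

Lemma quasi_inverse b : `|b| < 1 -> exists s, s = b + b ** s.
Proof.
move=> b1; pose s n := iter n (fun x => b + b ** x) 0.
have b1' : 0 < 1 - `|b| by rewrite subr_gt0.
pose M := `|b| / (1 - `|b|).
have sM n : `|s n| <= M.
  elim: n => [|n ih]; first by rewrite normr0 divr_ge0// ltW.
  rewrite /= (le_trans (ler_normD _ _))//.
  rewrite (@le_trans _ _ (`|b| + `|b| * M))//.
    by rewrite lerD2l (le_trans (ler_norm_bmul _ _))// ler_wpM2l.
  rewrite le_eqVlt; apply/orP; left; apply/eqP.
  rewrite /M -{1}[`|b|](mulfK (lt0r_neq0 b1')) mulrA -mulrDl.
  by congr (_ / _); rewrite mulrBr mulr1 subrK.
have sd n k : `|s (n + k)%N - s n| <= `|b| ^+ n * M.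
  elim: n => [|n ih]; first by rewrite subr0 mul1r add0n.
  rewrite addSn /= opprD addrACA subrr add0r -bmulBr.
  by rewrite (le_trans (ler_norm_bmul _ _))// exprS -mulrA ler_wpM2l.
have M0 : 0 <= M by exact: le_trans (sM 0%N).
have scv : cvg (s @ \oo).
  apply: cauchy_cvg; apply: cauchy_exP => e e0.
  have : exists n, `|b| ^+ n * M < e.
    have := b1; rewrite -(ge0_Re (normr_ge0 b)); set q := complex.Re _ => q1.
    have q0 : 0 <= q by rewrite -ler0c ge0_Re.
    have {}q1 : `|q| < 1 by rewrite ger0_norm// -ltcR.
    have [r r0 ->] := posC_realP e0.
    rewrite -(ge0_Re M0); set m := complex.Re M.
    have m0 : 0 <= m by rewrite -ler0c ge0_Re.
    have : (q ^+ n * m) @[n --> \oo] --> 0 * m.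
      by apply: cvgM; [exact: cvg_expr|exact: cvg_cst].
    rewrite mul0r => /cvgrPdist_lt/(_ _ r0)[n _ /(_ n (leqnn n))] /=.
    rewrite sub0r normrN ger0_norm ?mulr_ge0 ?exprn_ge0// => nr.
    by exists n; rewrite -rmorphXn -rmorphM ltcR.
  case=> n ne; exists (s n); exists n => // k /= nk.
  rewrite -ball_normE /= distrC -(subnKC nk).
  by rewrite (le_lt_trans (sd _ _)).
case/cvg_ex: scv => l sl; exists l.
have sl1 : s n.+1 @[n --> \oo] --> l.
  move: sl; rewrite -cvg_shiftS; exact.
apply: (cvg_unique _ sl1) => //.
apply: cvgD; first exact: cvg_cst.
by apply: continuous_cvg => //; exact: bmul_continuous.
Qed.

Lemma ler_norm_character (phi : A -> C^o) a :
  characters A phi -> `|phi a| <= `|a|.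
Proof.
move=> [lphi mphi _]; rewrite real_leNgt ?normr_real//; apply/negP => phia.
have pa0 : 0 < `|phi a| by exact: le_lt_trans phia.
have na0 : phi a != 0 by rewrite -normr_gt0.
pose L : {linear A -> C^o} :=
  HB.pack_for {linear A -> C^o} phi (GRing.isLinear.Build C A C^o *:%R phi lphi).
pose b := (phi a)^-1 *: a.
have phib : phi b = 1.
  by rewrite /b -[phi]/(L : _ -> _) linearZ /= /GRing.scale/= mulVf.
have [|s sE] := @quasi_inverse b.
  by rewrite normrZ normfV mulrC ltr_pdivrMr// mul1r.
have : L s = L (b + b ** s) by rewrite -sE.
rewrite linearD /= mphi phib mul1r => /eqP.
by rewrite -subr_eq subrr eq_sym oner_eq0.
Qed.

Lemma character_dual_subproof (phi : A -> C^o) : characters A phi ->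
  phi \in continuous_linear_form A.
Proof.
move=> cphi; apply: (@continuous_linear_formP _ _ _ 1); first by case: cphi.
by move=> x; rewrite mul1r ler_norm_character.
Qed.

Definition character_dual (phi : A -> C^o) (cphi : characters A phi) : dual A :=
  Dual (character_dual_subproof cphi).

End automatic_continuity.

Section second_transpose.
Context {R : realType} {A : banachAlgType R[i]}.
Local Notation C := R[i].
Variable f : dual A.

Fact second_transpose_linear :
  linear (fun F : bidual A => (F : dual (dual A)) f : C^o).
Proof. by []. Qed.

Fact second_transpose_bounded (F : bidual A) :
  `|(F : dual (dual A)) f| <= (complex.Re `|f|)%:C * `|F|.
Proof. by rewrite ge0_Re// mulrC ler_dual. Qed.

(* The second transpose of f : A -> C is a map A^** -> C^** = C; under the
   identification of C^** with C it is evaluation at f. *)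
Definition second_transpose : dual (bidual A) :=
  mk_dual second_transpose_linear second_transpose_bounded.

End second_transpose.

(* Main.v *)
Require Import Defs.
From HB Require Import structures.
From mathcomp Require Import all_boot all_order all_algebra.
From mathcomp Require Import complex.
From mathcomp Require Import all_classical all_reals.
From mathcomp Require Import topology normedtype sequences.

(** If d is a point derivation at phi, then d.a = d(a) phi + phi(a) d, hence
    G d = <G, phi> d + <G, d> phi for G in A^**, and applying F in A^** gives
    the derivation rule for d^** at phi^**; this includes phi = 0.
    Multiplicativity of phi^** follows in the same way from phi.a = phi(a) phi.
    Conversely, evaluation embeds A multiplicatively into A^**, and d^**
    restricts to d along it. *)

Set Implicit Arguments.
Unset Strict Implicit.
Unset Printing Implicit Defensive.

Import Order.TTheory GRing.Theory Num.Theory.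
Import numFieldNormedType.Exports.

Local Open Scope classical_set_scope.
Local Open Scope complex_scope.
Local Open Scope ring_scope.

Section second_transpose_theory.
Context {R : realType} {A : banachAlgType R[i]}.
Implicit Types (a b : A) (f phi d : dual A) (F G : bidual A).

Fact bidual_eval_bounded a f : `|f a| <= (complex.Re `|a|)%:C * `|f|.
Proof. by rewrite ge0_Re// mulrC ler_dual. Qed.

Fact bidual_eval_linear a : linear (fun f => f a : R[i]^o).
Proof. by []. Qed.

(** The canonical embedding of A into its second dual, typed in [bidual A] so that [**] on its
    values is the Arens product. *)
Definition bidual_eval a : bidual A :=
  mk_dual (bidual_eval_linear a) (bidual_eval_bounded a).

Lemma second_transpose_eval f a : second_transpose f (bidual_eval a) = f a.
Proof. by []. Qed.

(** Unfolding the Arens product at f turns the left side into [f (a ** b)]. *)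
Lemma bidual_evalM a b : bidual_eval a ** bidual_eval b = bidual_eval (a ** b).
Proof. exact: dualP. Qed.

Lemma second_transpose_eq0 f : second_transpose f = 0 -> f = 0.
Proof. by move=> f0; apply: dualP => a; rewrite -second_transpose_eval f0. Qed.

(** Stated for any [phi] in the dual, so that one equivalence serves both characters and the zero
    functional. *)
Lemma second_transpose_point_derivation phi d :
  point_derivation phi d <->
  @point_derivation R (bidual A) (second_transpose phi) (second_transpose d).
Proof.
split=> [pd F G|pd a b]; last first.
  by rewrite -second_transpose_eval -bidual_evalM pd.
have ractE a : dual_ract d a = d a *: phi + phi a *: d.
  by apply: dualP => x; rewrite dualD !dualZ /= pd.
have lactE : bidual_lact G d =
    (G : dual (dual A)) phi *: d + (G : dual (dual A)) d *: phi.
  apply: dualP => a; rewrite dualD !dualZ /= ractE linearD !linearZ /=.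
  by congr (_ + _); exact: mulrC.
(* By definition, d^** at the product F G is F applied to the functional G d. *)
change ((F : dual (dual A)) (bidual_lact G d) =
  (F : dual (dual A)) d * (G : dual (dual A)) phi +
  (F : dual (dual A)) phi * (G : dual (dual A)) d).
by rewrite lactE linearD !linearZ /=; congr (_ + _); exact: mulrC.
Qed.

Lemma second_transpose_character phi :
  characters A phi -> characters (bidual A) (second_transpose phi).
Proof.
move=> [_ phiM [a phia]]; split; [exact: second_transpose_linear| |].
- move=> F G.
  have ractE x : dual_ract phi x = phi x *: phi.
    by apply: dualP => y; rewrite dualZ /= phiM.
  have lactE : bidual_lact G phi = (G : dual (dual A)) phi *: phi.
    apply: dualP => x; rewrite dualZ /= ractE linearZ /=; exact: mulrC.
  change ((F : dual (dual A)) (bidual_lact G phi) =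
    (F : dual (dual A)) phi * (G : dual (dual A)) phi).
  by rewrite lactE linearZ /=; exact: mulrC.
(* At the evaluation at a, phi^** takes the value [phi a], which is nonzero. *)
- by exists (bidual_eval a).
Qed.

End second_transpose_theory.

Theorem proposition5p2 (R : realType) (A : banachAlgType R[i]) :
  (forall (phi : A -> R[i]^o) (cphi : characters A phi),
     characters (bidual A) (second_transpose (character_dual cphi)) /\
     forall d : dual A,
       point_derivation phi d <->
       @point_derivation R (bidual A)
         (second_transpose (character_dual cphi)) (second_transpose d)) /\
  (point_amenable (bidual A) -> point_amenable A) /\
  (zero_point_amenable (bidual A) -> zero_point_amenable A).
Proof.
split; [|split].
- move=> phi cphi; split; first exact: second_transpose_character.
  move=> d; exact: (second_transpose_point_derivation (character_dual cphi)).
- move=> pA phi cphi d pd; apply/second_transpose_eq0.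
  apply: (pA (second_transpose (character_dual cphi))).
    exact: second_transpose_character.
  exact: (iffLR (second_transpose_point_derivation (character_dual cphi) d)).
- move=> pA phi [cphi|->] d pd; apply/second_transpose_eq0.
    apply: (pA (second_transpose (character_dual cphi))).
      by left; exact: second_transpose_character.
    exact: (iffLR (second_transpose_point_derivation (character_dual cphi) d)).
  (* The zero function is the zero element of [dual A]; its second transpose sends F to F(0) = 0,
     hence lies in [characters0]. *)
  apply: (pA (second_transpose (0 : dual A))); last first.
    exact: (iffLR (second_transpose_point_derivation 0 d)).
  by right; apply/funext => F; exact: (linear0 (F : dual (dual A))).
Qed.
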